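(* Let $n \geq r$ and let $\mathcal{E}(r)=\{g_0=\emptyset,g_1,\ldots,g_m\}$. For every graph $h\in\mathcal{E}(n)$ the vector $z=(z_0,z_1,\ldots,z_m)^T$ with $z_i=I(g_i)(h)$ (so $z_0=1$) satisfies $$z\in\mathbb{Z}^{m+1},\quad z\geq 0,$$ $$(E^T)^{-1}Dz\geq 0,$$ $$z_iz_j-\sum_{k=0}^m c_{ij}^k z_k=0\quad\text{for all } i,j \text{ such that } cv(g_i)+cv(g_j)\leq r,$$ where inequalities are componentwise, $E$ is the $E$-transform of $\mathcal{E}(r)$, $$D=\mathrm{diag}\left(\binom{n}{r},\binom{n-cv(g_1)}{r-cv(g_1)},\ldots,\binom{n-cv(g_m)}{r-cv(g_m)}\right),$$ and $c_{ij}^k=\sum_{l=0}^m(-1)^{|g_k|-|g_l|}e_{kl}e_{li}e_{lj}$.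
   Context: All graphs are finite and simple. $\mathcal{E}(n)$ is the set of isomorphism classes of simple graphs with $n$ vertices. For graphs $g,h$, $I(g)(h)$ is the number of (not necessarily induced) subgraphs of $h$ isomorphic to $g$, isolated vertices being disregarded: it is the number of edge subsets of $h$ which, as graphs without isolated vertices, are isomorphic to $g$ with its isolated vertices removed. $I(\emptyset)=1$ for the graph $\emptyset$ without edges. $|g|$ is the number of edges of $g$ and $cv(g)$ is the number of vertices of $g$ having at least one edge connected to them. The $E$-transform of $\mathcal{E}(r)=\{g_0,\ldots,g_m\}$ is the (invertible) matrix $E=(e_{ij})_{0\le i,j\le m}$ with $e_{ij}=I(g_j)(g_i)$. *)

(* Defs.v *)
From HB Require Import structures.
From mathcomp Require Import all_boot all_order all_algebra.

Set Implicit Arguments.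
Unset Strict Implicit.
Unset Printing Implicit Defensive.

Import Order.TTheory GRing.Theory Num.Theory.

(* Edges are two-element vertex sets, so the subgraphs of a graph with the
   same vertex type are exactly its edge subsets. *)
Record sgraph (V : finType) := SGraph {
  edges : {set {set V}};
  edges_card2 : [forall e in edges, #|e| == 2] }.

HB.instance Definition _ (V : finType) := [isSub for @edges V].
HB.instance Definition _ (V : finType) := [Finite of sgraph V by <:].

Definition nedges (V : finType) (g : sgraph V) : nat := #|edges g|.

Definition nonisolated (V : finType) (g : sgraph V) : {set V} :=
  cover (edges g).

Definition cv (V : finType) (g : sgraph V) : nat := #|nonisolated g|.

Definition giso (V W : finType) (g : sgraph V) (h : sgraph W) : bool :=
  [exists f : {ffun V -> W},
    [&& injectiveb f, [forall w, exists v, f v == w]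
      & edges h == [set f @: (e : {set V}) | e in edges g]]].

Lemma gisoP (V W : finType) (g : sgraph V) (h : sgraph W) :
  reflect (exists2 f : V -> W, bijective f &
             edges h = [set f @: (e : {set V}) | e in edges g])
          (giso g h).
Proof.
apply: (iffP existsP) => [[f /and3P[/injectiveP fI /forallP fS /eqP fE]]|].
  exists f => //; apply: inj_card_bij => //.
  rewrite -(card_codom fI); apply/subset_leq_card/subsetP => w _.
  by have /existsP[v /eqP <-] := fS w; apply: codom_f.
case=> f [f' fK f'K] fE; exists [ffun v => f v]; apply/and3P; split.
- by apply/injectiveP => x y; rewrite !ffunE => /(can_inj fK).
- by apply/forallP => w; apply/existsP; exists (f' w); rewrite ffunE f'K.
- rewrite fE; apply/eqP/eq_imset => e.
  by apply: eq_imset => v; rewrite ffunE.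
Qed.

Lemma strip_card2 (V : finType) (g : sgraph V) :
  [forall e in [set e : {set {x : V | x \in nonisolated g}}
                  | val @: e \in edges g], #|e| == 2].
Proof.
apply/forall_inP => e; rewrite inE => /(forall_inP (edges_card2 g)).
by rewrite card_imset //; apply: val_inj.
Qed.

(* g with its isolated vertices removed. *)
Definition strip (V : finType) (g : sgraph V) :
    sgraph {x : V | x \in nonisolated g} :=
  SGraph (strip_card2 g).

(* I(g)(h). *)
Definition subgraph_count (V W : finType) (g : sgraph V) (h : sgraph W) : nat :=
  #|[set s : sgraph W | (edges s \subset edges h) && giso (strip s) (strip g)]|.

(* Isomorphism classes of graphs with r vertices are given by representatives
   on 'I_r: g lists each class exactly once, the edgeless graph first. *)
Definition lists_classes (r m : nat) (g : 'I_m.+1 -> sgraph 'I_r) : Prop :=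
  [/\ edges (g ord0) = set0,
      forall i j, giso (g i) (g j) -> i = j
    & forall h : sgraph 'I_r, exists i, giso h (g i)].

Local Open Scope ring_scope.

Definition Etransform (r m : nat) (g : 'I_m.+1 -> sgraph 'I_r) :
    'M[rat]_m.+1 :=
  \matrix_(i, j) (subgraph_count (g j) (g i))%:R.

Definition Dmatrix (n r m : nat) (g : 'I_m.+1 -> sgraph 'I_r) :
    'M[rat]_m.+1 :=
  diag_mx (\row_i ('C(n - cv (g i), r - cv (g i)))%:R).

Definition structure_coef (r m : nat) (g : 'I_m.+1 -> sgraph 'I_r)
    (i j k : 'I_m.+1) : rat :=
  let E := Etransform g in
  \sum_(l < m.+1)
    (-1) ^ ((nedges (g k))%:Z - (nedges (g l))%:Z) * E k l * E l i * E l j.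

(* Invertibility of the E-transform, so that [invmx (Etransform g)^T] is a
   genuine inverse. *)

Lemma edge_sub_nonisolated (V : finType) (g : sgraph V) (e : {set V}) :
  e \in edges g -> e \subset nonisolated g.
Proof. by move=> eg; apply/subsetP => x xe; apply/bigcupP; exists e. Qed.

Lemma edges_strip (V : finType) (g : sgraph V) :
  edges g = [set val @: (e : {set _}) | e in edges (strip g)].
Proof.
apply/setP => e; apply/idP/imsetP => [eg|[e' + ->]]; last by rewrite inE.
pose e' := [set x : {x : V | x \in nonisolated g} | val x \in e].
have eE : e = val @: e'.
  apply/setP => x; apply/idP/imsetP => [xe|[y + ->]]; last by rewrite inE.
  have xg := subsetP (edge_sub_nonisolated eg) x xe.
  by exists (Sub x xg); rewrite ?inE.
by exists e'; rewrite // inE -eE.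
Qed.

Lemma nedges_strip (V : finType) (g : sgraph V) : nedges (strip g) = nedges g.
Proof.
rewrite [RHS]/nedges edges_strip card_imset //.
exact/imset_inj/val_inj.
Qed.

Lemma giso_nedges (V W : finType) (g : sgraph V) (h : sgraph W) :
  giso g h -> nedges g = nedges h.
Proof.
case/gisoP => f /bij_inj fI hE; rewrite /nedges hE card_imset //.
exact: imset_inj.
Qed.

Lemma giso_refl (V : finType) (g : sgraph V) : giso g g.
Proof.
apply/gisoP; exists id; first exact: (Bijective (g := id)).
by rewrite (eq_imset _ (@imset_id _)) imset_id.
Qed.

Lemma giso_strip (V : finType) (g h : sgraph V) :
  giso (strip g) (strip h) -> giso g h.
Proof.
case/gisoP => F Fbij FE; have FI := bij_inj Fbij.
set A := nonisolated g; set B := nonisolated h.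
have cAB : #|A| = #|B|.
  by have := bij_eq_card Fbij; rewrite !card_sig.
have cC : size (enum (~: A)) = size (enum (~: B)).
  by apply: (@addnI #|A|); rewrite -!cardE cardsC cAB cardsC.
pose f v := if insub v is Some u then val (F u)
            else nth v (enum (~: B)) (index v (enum (~: A))).
have fA (u : {x | x \in A}) : f (val u) = val (F u) by rewrite /f valK.
have fnA v : v \notin A -> f v \notin B.
  move=> vA; rewrite /f insubN // -in_setC -mem_enum.
  by rewrite mem_nth // -cC index_mem mem_enum in_setC.
have fAB v : v \in A -> f v \in B.
  by move=> vA; rewrite -[v]/(val (Sub v vA : {x | x \in A})) fA (valP (F _)).
have fI : injective f.
  move=> v w; have [vA|vA] := boolP (v \in A); have [wA|wA] := boolP (w \in A).
  - rewrite -[v]/(val (Sub v vA : {x | x \in A})).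
    rewrite -[w]/(val (Sub w wA : {x | x \in A})).
    by rewrite !fA => /val_inj/FI ->.
  - by move=> fvw; have := fnA w wA; rewrite -fvw fAB.
  - by move=> fvw; have := fnA v vA; rewrite fvw fAB.
  have vC : v \in enum (~: A) by rewrite mem_enum in_setC.
  have wC : w \in enum (~: A) by rewrite mem_enum in_setC.
  rewrite /f !insubN // (set_nth_default w) -?cC ?index_mem // => /eqP.
  rewrite nth_uniq ?enum_uniq -?cC ?index_mem // => /eqP.
  exact: index_inj.
apply/gisoP; exists f; first exact: injF_bij.
rewrite edges_strip FE [in RHS]edges_strip -!imset_comp.
apply: eq_imset => e /=; rewrite -!imset_comp.
by apply: eq_imset => u /=; rewrite fA.
Qed.

Lemma Etransform_unit (r m : nat) (g : 'I_m.+1 -> sgraph 'I_r) :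
  lists_classes g -> Etransform g \in unitmx.
Proof.
case=> _ gI _; rewrite -unitmx_tr -row_free_unit -kermx_eq0.
apply/rowV0P => v /sub_kermxP vE; apply/eqP/contraT => /rV0Pn[i0 vi0].
pose i := [arg min_(i < i0 | v 0 i != 0) nedges (g i)].
have [vi imin] : v 0 i != 0 /\
    forall j, v 0 j != 0 -> (nedges (g i) <= nedges (g j))%N.
  by rewrite /i; case: arg_minnP.
have := congr1 (fun M : 'rV_m.+1 => M 0 i) vE.
rewrite !mxE (bigD1 i) //= big1 ?addr0 => [|j ji]; last first.
  have [->|vj] := eqVneq (v 0 j) 0; first by rewrite mul0r.
  rewrite !mxE [subgraph_count _ _](_ : _ = 0%N) ?mulr0 //.
  apply: eq_card0 => s; rewrite !inE; apply/negP => /andP[sg sj].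
  have sE : s = g i.
    apply/val_inj/eqP; rewrite eqEcard sg /=.
    have /= := giso_nedges sj; rewrite !nedges_strip /nedges => ->.
    exact: imin.
  by case/eqP: ji; apply/esym/gI/giso_strip; rewrite -sE.
move/eqP; rewrite !mxE mulf_eq0 (negPf vi) pnatr_eq0 /= cards_eq0.
by move/eqP/setP/(_ (g i)); rewrite !inE subxx giso_refl.
Qed.

(* Main.v *)
Require Import Defs.
From mathcomp Require Import all_boot all_order all_algebra.

Set Implicit Arguments.
Unset Strict Implicit.
Unset Printing Implicit Defensive.

Import Order.TTheory GRing.Theory Num.Theory.
Local Open Scope ring_scope.

(* Sorting the vertex sets S of size r by the class of h[S] gives a nonnegative
   vector x, and double counting the copies of g_i inside the graphs h[S] gives
   E^T x = D z.  For the quadratic relations, z_i z_j counts the pairs of copies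
   of g_i and g_j in h; their union u has at most r non-isolated vertices, so it
   belongs to some class g_k, and Moebius inversion over the edge subsets of u
   shows that the number of pairs with union exactly u is c_ij^k. *)

(** * Counting supersets, and Moebius inversion on the subset lattice *)

Lemma card_supersets (T : finType) (A : {set T}) (r : nat) :
  (#|A| <= r)%N ->
  #|[set S : {set T} | (#|S| == r) && (A \subset S)]|
    = 'C(#|T| - #|A|, r - #|A|).
Proof.
move=> Ar; rewrite -(cardsC A) addKn -cards_draws.
(* Adding [A] is a bijection from the subsets of [~: A] of size [r - #|A|] onto the supersets
   counted; removing [A] inverts it. *)
rewrite -[RHS](card_in_imset (f := fun B => A :|: B)); last first.
  move=> B C; rewrite !inE => /andP[BA _] /andP[CA _] /= eBC.
  have dis (X : {set T}) : X \subset ~: A -> (A :|: X) :\: A = X.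
    move=> XA; rewrite setDUl setDv set0U; apply/setDidPl.
    by rewrite -[A]setCK disjoints_subset setCK.
  by rewrite -(dis B BA) -(dis C CA) eBC.
apply: eq_card => S; rewrite inE; apply/andP/imsetP.
  case=> /eqP Sr AS; exists (S :\: A).
    by rewrite !inE setDE subsetIr -setDE cardsD (setIidPr AS) Sr eqxx.
  by rewrite setDE setUIr setUCr setIT (setUidPr AS).
case=> B; rewrite !inE => /andP[BA /eqP Bc] ->; rewrite subsetUl; split=> //.
rewrite cardsU (_ : A :&: B = set0) ?cards0 ?subn0 ?Bc ?subnKC //.
by apply/eqP; rewrite setI_eq0 disjoint_sym disjoints_subset.
Qed.

(* The sum is the expansion of a product over T whose factors are -1 on C, 0 on
   A :\: C and 1 outside A. *)
Lemma alternating_sum_interval (R : comNzRingType) (T : finType)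
    (A C : {set T}) : C \subset A ->
  \sum_(B : {set T} | (C \subset B) && (B \subset A)) (-1) ^+ #|B|
    = if C == A then (-1) ^+ #|A| else 0 :> R.
Proof.
move=> CA.
pose a t : R := if t \in A then -1 else 0.
pose b t : R := if t \in C then 0 else 1.
have -> : \sum_(B : {set T} | (C \subset B) && (B \subset A)) (-1) ^+ #|B|
  = \prod_t (a t + b t).
  rewrite bigA_distr big_mkcond /=; apply: eq_bigr => B _.
  case: ifP => [/andP[CB BA]|].
    rewrite -prodr_const [RHS](bigID (mem B)) /= [X in _ * X]big1 ?mulr1.
      by apply: eq_bigr => t tB; rewrite tB /a (subsetP BA).
    move=> t tB; rewrite (negPf tB) /b.
    by rewrite (negPf (contra (subsetP CB t) tB)).
  move/negbT; rewrite negb_and => /orP[] /subsetPn[t t1 t2];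
    rewrite (bigD1 t) //= /a /b ?t1 (negPf t2) ?t1 mul0r //.
case: eqP => [eCA|/eqP neCA].
  rewrite -prodr_const [LHS](bigID (mem A)) /= [X in _ * X]big1 ?mulr1.
    by apply: eq_bigr => t tA; rewrite /a /b eCA tA addr0.
  by move=> t tA; rewrite /a /b eCA (negPf tA) add0r.
have /subsetPn[t tA tC] : ~~ (A \subset C).
  by apply: contra neCA => AC; rewrite eqEsubset CA.
by rewrite (bigD1 t) //= /a /b tA (negPf tC) addNr mul0r.
Qed.

(** After exchanging the sums, the coefficient of [F C] is an alternating sum over the interval from
    [C] to [A], which vanishes unless [C = A]. The exponent [#|A| + #|B|] has the parity of the
    usual difference. *)
Lemma moebius_inversion_set (R : comNzRingType) (T : finType)
    (F : {set T} -> R) (A : {set T}) :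
  F A = \sum_(B : {set T} | B \subset A)
          (-1) ^+ (#|A| + #|B|) * \sum_(C : {set T} | C \subset B) F C.
Proof.
under eq_bigr do rewrite mulr_sumr.
rewrite (exchange_big_dep (fun C : {set T} => C \subset A)) /=; last first.
  by move=> B C BA CB; apply: subset_trans BA.
have coefE (C : {set T}) : C \subset A ->
    \sum_(B : {set T} | (B \subset A) && (C \subset B))
       (-1) ^+ (#|A| + #|B|) * F C = if C == A then F C else 0.
  move=> CA; rewrite -mulr_suml; under eq_bigr do rewrite exprD.
  rewrite -mulr_sumr; under eq_bigl do rewrite andbC.
  rewrite alternating_sum_interval //; case: eqP => _.
    by rewrite -exprD -signr_odd oddD addbb mul1r.
  by rewrite mulr0 mul0r.
rewrite (bigD1 A) //= coefE // eqxx big1 ?addr0 // => C /andP[CA neCA].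
by rewrite coefE // (negPf neCA).
Qed.

(** * Isomorphism up to isolated vertices, and images under injections *)

Definition sim (V W : finType) (s : sgraph V) (t : sgraph W) : bool :=
  giso (strip s) (strip t).

Lemma giso_sym (V W : finType) (s : sgraph V) (t : sgraph W) :
  giso s t -> giso t s.
Proof.
case/gisoP => f [f' fK f'K] fE; apply/gisoP; exists f'; first by exists f.
rewrite fE -imset_comp -[LHS]imset_id; apply: eq_imset => e /=.
by rewrite -imset_comp -[LHS]imset_id; apply: eq_imset => x /=; rewrite fK.
Qed.

Lemma giso_trans (U V W : finType) (s : sgraph V) (q : sgraph U)
    (t : sgraph W) : giso q s -> giso s t -> giso q t.
Proof.
case/gisoP => f fb fE /gisoP[f2 f2b f2E].
apply/gisoP; exists (f2 \o f); first exact: bij_comp.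
rewrite f2E fE -imset_comp; apply: eq_imset => e /=.
by rewrite -imset_comp.
Qed.

Lemma sim_sym (V W : finType) (s : sgraph V) (t : sgraph W) :
  sim s t -> sim t s.
Proof. exact: giso_sym. Qed.

Lemma sim_trans (U V W : finType) (s : sgraph V) (q : sgraph U)
    (t : sgraph W) : sim q s -> sim s t -> sim q t.
Proof. exact: giso_trans. Qed.

Lemma sim_nedges (V W : finType) (s : sgraph V) (t : sgraph W) :
  sim s t -> nedges s = nedges t.
Proof. by move/giso_nedges; rewrite !nedges_strip. Qed.

Lemma sim_cv (V W : finType) (s : sgraph V) (t : sgraph W) :
  sim s t -> cv s = cv t.
Proof. by case/gisoP => f /bij_eq_card; rewrite !card_sig. Qed.

Section Push.
Variables (V W : finType) (f : V -> W).
Hypothesis f_inj : injective f.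

Lemma push_card2 (s : sgraph V) :
  [forall e in [set f @: (e : {set V}) | e in edges s], #|e| == 2].
Proof.
apply/forall_inP => _ /imsetP[e es ->]; rewrite card_imset //.
exact: (forall_inP (edges_card2 s)).
Qed.

Definition push (s : sgraph V) : sgraph W := SGraph (push_card2 s).

Lemma push_inj : injective push.
Proof.
move=> s t /(congr1 (@edges W)) /= /imset_inj H.
by apply/val_inj/H/imset_inj.
Qed.

Lemma nonisolated_push s : nonisolated (push s) = f @: nonisolated s.
Proof. by rewrite /nonisolated cover_imset imset_cover. Qed.

Lemma sim_push s : sim s (push s).
Proof.
have fs (x : {x | x \in nonisolated s}) : f (val x) \in nonisolated (push s).
  by rewrite nonisolated_push imset_f // (valP x).
pose F x : {y | y \in nonisolated (push s)} := Sub (f (val x)) (fs x).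
have F_inj : injective F.
  by move=> x y /(congr1 val) /= /f_inj /val_inj.
apply/gisoP; exists F.
  apply: inj_card_bij => //.
  by rewrite !card_sig -(card_imset (mem (nonisolated s)) f_inj)
    -nonisolated_push.
(* Edge sets over the subtype of non-isolated vertices are compared through their images in [W],
   which [edges_strip] computes. *)
apply: (imset_inj (imset_inj val_inj)).
rewrite -edges_strip /= [in LHS]edges_strip -!imset_comp.
by apply: eq_imset => e /=; rewrite -!imset_comp; apply: eq_imset.
Qed.

Lemma push_sub_inv (s : sgraph V) (w : sgraph W) :
  edges w \subset edges (push s) ->
  exists2 s' : sgraph V, edges s' \subset edges s & w = push s'.
Proof.
move=> ws; pose A := [set e in edges s | f @: e \in edges w].
have A2 : [forall e in A, #|e| == 2].
  apply/forall_inP => e; rewrite inE => /andP[es _].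
  exact: (forall_inP (edges_card2 s)).
exists (SGraph A2); first by apply/subsetP => e; rewrite inE => /andP[].
apply/val_inj/setP => e /=; apply/idP/imsetP => [ew|[e']].
  have /imsetP[e' e's eE] := subsetP ws e ew.
  by exists e'; rewrite // inE e's -eE.
by rewrite inE => /andP[_ ?] ->.
Qed.

(** [push] is a bijection from the subgraphs of [s] to those of [push s], and it keeps each subgraph
    in its similarity class. *)
Lemma subgraph_count_push (X : finType) (g : sgraph X) s :
  subgraph_count g (push s) = subgraph_count g s.
Proof.
rewrite /subgraph_count -[RHS](card_imset _ push_inj).
apply: eq_card => w; rewrite !inE; apply/andP/imsetP.
  case=> /push_sub_inv[s' s's ->] s'g; exists s' => //.
  by rewrite inE s's /=; apply: giso_trans s'g; apply: sim_push.
case=> s'; rewrite inE => /andP[s's s'g] ->; split; first exact: imsetS.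
exact: giso_trans (giso_sym (sim_push s')) s'g.
Qed.

End Push.

(* Together with [sim_push], this reduces statements about similar graphs to
   images under injections. *)
Lemma push_strip (V : finType) (s : sgraph V) : s = push val_inj (strip s).
Proof. by apply/val_inj; rewrite /= -edges_strip. Qed.

Lemma subgraph_count_sim (V W X : finType) (g : sgraph X) (s : sgraph V)
    (t : sgraph W) : sim s t -> subgraph_count g s = subgraph_count g t.
Proof.
case/gisoP => f /bij_inj f_inj fE.
have tE : strip t = push f_inj (strip s) by apply/val_inj.
rewrite [in RHS](push_strip t) subgraph_count_push tE.
by rewrite subgraph_count_push [in LHS](push_strip s) subgraph_count_push.
Qed.

Lemma subgraph_cv (V : finType) (s t : sgraph V) :
  edges s \subset edges t -> (cv s <= cv t)%N.
Proof.
move=> st; apply/subset_leq_card/bigcupsP => e es.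
exact/edge_sub_nonisolated/(subsetP st).
Qed.

Lemma sum_edge_sets (R : nmodType) (V : finType) (u : sgraph V)
    (F : {set {set V}} -> R) :
  \sum_(A : {set {set V}} | A \subset edges u) F A
    = \sum_(w : sgraph V | edges w \subset edges u) F (edges w).
Proof.
(* The default [u] is never reached: a subset of [edges u] consists of two-element sets, so it is
   itself an edge set. *)
rewrite (reindex_onto (@edges V) (insubd u)) => [|A Au]; last first.
  rewrite insubdK //; apply/forall_inP => e eA.
  by apply: (forall_inP (edges_card2 u)); apply: (subsetP Au).
by apply: eq_bigl => w; rewrite valKd eqxx andbT.
Qed.

(** * Sorting graphs by the listed classes *)

Section Classes.
Variables (r m : nat) (g : 'I_m.+1 -> sgraph 'I_r).
Hypothesis hg : lists_classes g.

Lemma sim_class_inj i j : sim (g i) (g j) -> i = j.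
Proof. by case: hg => _ gI _ /giso_strip/gI. Qed.

Lemma sim_class_ex (V : finType) (s : sgraph V) :
  (cv s <= r)%N -> exists k, sim s (g k).
Proof.
move=> sr; case: hg => _ _ gE.
have cr : (#|{: {x | x \in nonisolated s}}| <= r)%N by rewrite card_sig.
(* The at most [r] non-isolated vertices of [s] embed into ['I_r], where the image of [strip s] is
   isomorphic to a listed graph. *)
pose f x := widen_ord cr (enum_rank x).
have f_inj : injective f.
  by move=> x y /(congr1 val) /= /val_inj/enum_rank_inj.
have [k /gisoP[F /bij_inj FI FE]] := gE (push f_inj (strip s)).
exists k; have -> : g k = push FI (push f_inj (strip s)) by apply/val_inj.
apply: sim_trans (sim_push FI _); apply: sim_trans (sim_push f_inj _).
by rewrite [s in sim s _]push_strip; apply/sim_sym/sim_push.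
Qed.

Lemma cv_class k : (cv (g k) <= r)%N.
Proof. by rewrite -[leqRHS]card_ord max_card. Qed.

Lemma sum_sim_class (R : pzRingType) (V : finType) (s : sgraph V)
    (b : 'I_m.+1 -> R) k :
  sim s (g k) -> \sum_(j | sim s (g j)) b j = b k.
Proof.
move=> sk; rewrite (big_pred1 k) // => j.
apply/idP/eqP => [sj|-> //]; apply: sim_class_inj.
exact: sim_trans (sim_sym sj) sk.
Qed.

(** Subgraphs of [u] are grouped by class, class [k] having [subgraph_count (g k) u] members. Those
    with more than [r] non-isolated vertices lie in no class, so their terms must vanish. *)
Lemma sum_by_class (R : pzRingType) (V : finType) (u : sgraph V)
    (a : sgraph V -> R) (b : 'I_m.+1 -> R) :
    (forall w k, edges w \subset edges u -> sim w (g k) -> a w = b k) ->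
    (forall w, edges w \subset edges u -> (r < cv w)%N -> a w = 0) ->
  \sum_(w | edges w \subset edges u) a w
    = \sum_k b k * (subgraph_count (g k) u)%:R.
Proof.
move=> ab a0.
transitivity (\sum_(w | edges w \subset edges u)
                \sum_(k | sim w (g k)) b k).
  apply: eq_bigr => w wu; case: (leqP (cv w) r) => [|wr].
    by case/sim_class_ex => k wk; rewrite (ab w k) // (sum_sim_class _ wk).
  rewrite a0 // big_pred0 // => k; apply/negbTE/negP => /sim_cv wk.
  by move: wr; rewrite ltnNge wk cv_class.
rewrite (exchange_big_dep predT) //=; apply: eq_bigr => k _.
rewrite sumr_const mulr_natr; congr (_ *+ _).
by apply: eq_card => w; rewrite inE.
Qed.


Lemma subgraph_count_edgeless (W : finType) (h : sgraph W) :
  subgraph_count (g ord0) h = 1%N.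
Proof.
have [g0 gI _] := hg.
have e2 : [forall e in (set0 : {set {set W}}), #|e| == 2].
  by apply/forall_inP => e; rewrite inE.
have nedges0 (V : finType) (s : sgraph V) : nedges s = 0%N <-> edges s = set0.
  by split=> [/cards0_eq|]; rewrite /nedges // => ->; rewrite cards0.
(* The edgeless graph on [W] has some class [k]; equal edge numbers make [g k] edgeless, which
   forces [k = ord0]. *)
have [k kE] : exists k, sim (SGraph e2) (g k).
  by apply: sim_class_ex; rewrite /cv /nonisolated /= /cover big_set0 cards0.
have k0 : k = ord0.
  apply: gI; have <- : g ord0 = g k; last exact: giso_refl.
  apply/val_inj; rewrite /= g0; apply/esym/nedges0.
  by rewrite -(sim_nedges kE); apply/nedges0.
rewrite /subgraph_count -(cards1 (SGraph e2)); apply: eq_card => s.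
rewrite !inE; apply/andP/eqP => [[_ /sim_nedges]|->].
  rewrite (_ : nedges (g _) = 0%N); last exact/nedges0.
  by move/nedges0 => s0; apply/val_inj.
by split; [apply: sub0set | rewrite k0 in kE].
Qed.

(** * Double counting copies inside induced subgraphs *)

Section Induced.
Variables (W : finType) (h : sgraph W).

Lemma induced_card2 (S : {set W}) :
  [forall e in [set e in edges h | e \subset S], #|e| == 2].
Proof.
apply/forall_inP => e; rewrite inE => /andP[eh _].
exact: (forall_inP (edges_card2 h)).
Qed.

(* The vertices outside S are kept, as isolated vertices. *)
Definition induced (S : {set W}) : sgraph W := SGraph (induced_card2 S).

Lemma sub_induced (S : {set W}) (s : sgraph W) :
  (edges s \subset edges (induced S))
    = (edges s \subset edges h) && (nonisolated s \subset S).
Proof.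
apply/idP/andP => [sS|[sh sS]].
  split; first by apply/subsetP => e /(subsetP sS); rewrite inE => /andP[].
  by apply/bigcupsP => e /(subsetP sS); rewrite inE => /andP[].
apply/subsetP => e es; rewrite inE (subsetP sh) //=.
exact: subset_trans (edge_sub_nonisolated es) sS.
Qed.

Lemma cv_induced (S : {set W}) : (cv (induced S) <= #|S|)%N.
Proof.
apply/subset_leq_card/bigcupsP => e.
by rewrite inE => /andP[].
Qed.

(** Pairs of a copy [s] and an [r]-set [S] with [nonisolated s \subset S] are counted in two ways;
    for fixed [s], [card_supersets] gives the binomial. *)
Lemma sum_induced_counts i :
  \sum_(S : {set W} | #|S| == r) subgraph_count (g i) (induced S)
    = ('C(#|W| - cv (g i), r - cv (g i)) * subgraph_count (g i) h)%N.
Proof.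
under eq_bigr => S _ do rewrite /subgraph_count -sum1_card.
rewrite (exchange_big_dep
  (mem [set s : sgraph W | (edges s \subset edges h) && sim s (g i)]))
  => [|S s _]; last by rewrite /= !inE sub_induced => /andP[/andP[-> _]].
rewrite mulnC -sum_nat_const; apply: eq_bigr => s; rewrite [mem _ s]inE.
move=> /andP[sh si]; rewrite sum1_card -(sim_cv si).
rewrite -card_supersets; last by rewrite -/(cv s) (sim_cv si) cv_class.
apply: eq_card => S; rewrite [RHS]inE unfold_in inE sub_induced sh.
by rewrite -/(sim _ _) si andbT.
Qed.

(** Each [r]-set [S] induces a graph of exactly one class, and the number of copies of [g i] in it
    depends only on that class. Summing over [S] thus amounts to summing over classes with weights
    [x]. *)
Lemma Etransform_mul_induced (x : 'cV[rat]_m.+1) :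
    (forall k, x k 0
       = #|[set S : {set W} | (#|S| == r) && sim (induced S) (g k)]|%:R) ->
  forall i, ((Etransform g)^T *m x) i 0
    = ('C(#|W| - cv (g i), r - cv (g i)) * subgraph_count (g i) h)%:R.
Proof.
move=> xE i; rewrite -sum_induced_counts natr_sum !mxE.
transitivity (\sum_(S : {set W} | #|S| == r)
  \sum_(k | sim (induced S) (g k)) ((subgraph_count (g i) (g k))%:R : rat)).
  rewrite (exchange_big_dep predT) //=; apply: eq_bigr => k _.
  rewrite !mxE xE sumr_const mulr_natr; congr (_ *+ _).
  by apply: eq_card => S; rewrite !inE.
apply: eq_bigr => S /eqP Sr.
have [k kS] : exists k, sim (induced S) (g k).
  by apply: sim_class_ex; rewrite -Sr cv_induced.
by rewrite (sum_sim_class _ kS) (subgraph_count_sim _ kS).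
Qed.

End Induced.

(** * Pairs of copies with a prescribed union *)

(** [A] is an arbitrary set of vertex sets rather than a graph, so that [moebius_inversion_set]
    applies directly. *)
Definition union_count (V : finType) i j (A : {set {set V}}) : nat :=
  #|[set p : sgraph V * sgraph V |
      [&& sim p.1 (g i), sim p.2 (g j) & edges p.1 :|: edges p.2 == A]]|.

Lemma sum_union_count (V : finType) i j (u : sgraph V) :
  \sum_(A : {set {set V}} | A \subset edges u) union_count i j A
    = (subgraph_count (g i) u * subgraph_count (g j) u)%N.
Proof.
rewrite /subgraph_count -cardsX -sum1_card.
rewrite (partition_big (fun p => edges p.1 :|: edges p.2)
                       (fun A => A \subset edges u)) /=.
  apply: eq_bigr => A Au; rewrite /union_count -sum1_card; apply: eq_bigl.
  case=> s t; rewrite !inE /= -!/(sim _ _).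
  have [stA|] := eqVneq (edges s :|: edges t) A; last by rewrite !andbF.
  by move: Au; rewrite -stA subUset => /andP[-> ->]; rewrite !andbT.
by case=> s t; rewrite !inE /= subUset => /andP[/andP[-> _] /andP[-> _]].
Qed.

Lemma union_count_moebius (V : finType) i j (u : sgraph V) :
  (union_count i j (edges u))%:R
    = \sum_(w : sgraph V | edges w \subset edges u)
        (-1) ^+ (nedges u + nedges w)
          * ((subgraph_count (g i) w)%:R * (subgraph_count (g j) w)%:R) :> rat.
Proof.
rewrite (moebius_inversion_set (fun A => (union_count i j A)%:R)).
rewrite sum_edge_sets; apply: eq_bigr => w _.
by rewrite -natr_sum sum_union_count natrM.
Qed.

Lemma structure_coefE i j k : structure_coef g i j k
  = \sum_l (-1) ^+ (nedges (g k) + nedges (g l))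
      * ((subgraph_count (g i) (g l))%:R * (subgraph_count (g j) (g l))%:R)
      * (subgraph_count (g l) (g k))%:R.
Proof.
apply: eq_bigr => l _; rewrite !mxE expfzDr ?oppr_eq0 ?oner_eq0 //.
(* Since -1 is its own inverse, the integer difference of exponents becomes a sum of naturals. *)
rewrite -exprz_inv invrN1 -!exprnP exprD -!mulrA; congr (_ * (_ * _)).
by rewrite [LHS]mulrC mulrA.
Qed.

(** The Moebius sum over subgraphs of [u], grouped by class, is the sum defining the coefficient. No
    subgraph escapes the classes, because [cv u] is at most [r]. *)
Lemma union_count_class (V : finType) i j k (u : sgraph V) :
  sim u (g k) -> (union_count i j (edges u))%:R = structure_coef g i j k.
Proof.
move=> uk; rewrite union_count_moebius structure_coefE -(sim_nedges uk).
under [RHS]eq_bigr do rewrite -(subgraph_count_sim _ uk).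
apply: sum_by_class => [w l _ wl|w wu].
  by rewrite (sim_nedges wl) !(subgraph_count_sim _ wl).
by rewrite ltnNge (leq_trans (subgraph_cv wu)) // (sim_cv uk) cv_class.
Qed.

Lemma union_count_cv (V : finType) i j (u : sgraph V) :
  (cv (g i) + cv (g j) < cv u)%N -> union_count i j (edges u) = 0%N.
Proof.
move=> iju; apply: eq_card0 => -[s t]; rewrite !inE /=; apply/negP.
case/and3P => /sim_cv si /sim_cv tj /eqP stu; move: iju.
rewrite -si -tj ltnNge => /negP; apply.
apply: leq_trans (leq_card_setU _ _); apply/subset_leq_card/bigcupsP => e.
rewrite -stu inE => /orP[] /edge_sub_nonisolated es; apply: subset_trans es _.
  exact: subsetUl.
exact: subsetUr.
Qed.

(** Pairs of copies are sorted by their union [w]. The bound [r] on [cv (g i) + cv (g j)] ensures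
    that no union is too large to belong to a class. *)
Lemma mul_subgraph_count (V : finType) i j (h : sgraph V) :
    (cv (g i) + cv (g j) <= r)%N ->
  (subgraph_count (g i) h)%:R * (subgraph_count (g j) h)%:R
    = \sum_k structure_coef g i j k * (subgraph_count (g k) h)%:R.
Proof.
move=> ijr; rewrite -natrM -sum_union_count sum_edge_sets natr_sum.
apply: sum_by_class => w; first by move=> k _; apply: union_count_class.
by move=> _ /(leq_ltn_trans ijr) /union_count_cv ->.
Qed.

End Classes.

Theorem theorem1 (n r m : nat) (g : 'I_m.+1 -> sgraph 'I_r)
    (h : sgraph 'I_n) (z : 'cV[rat]_m.+1)
    (hrn : (r <= n)%N)
    (hg : lists_classes g)
    (hz : forall i, z i 0 = (subgraph_count (g i) h)%:R) :
  [/\ z ord0 0 = 1,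
      (forall i, z i 0 \is a Num.int) /\ (forall i, 0 <= z i 0),
      forall i, 0 <= (invmx (Etransform g)^T *m Dmatrix n g *m z) i 0
    & forall i j, (cv (g i) + cv (g j) <= r)%N ->
        z i 0 * z j 0 - \sum_(k < m.+1) structure_coef g i j k * z k 0 = 0].
Proof.
split.
- by rewrite hz subgraph_count_edgeless.
- by split=> i; rewrite hz ?ler0n ?rpred_nat.
- pose x : 'cV[rat]_m.+1 := \col_k
    #|[set S : {set 'I_n} | (#|S| == r) && sim (induced h S) (g k)]|%:R.
  have DzE : Dmatrix n g *m z = (Etransform g)^T *m x.
    apply/colP => i; rewrite (Etransform_mul_induced hg (h := h)) => [|k].
      by rewrite mul_diag_mx !mxE hz card_ord natrM.
    by rewrite mxE.
  (* Inverting the E-transform leaves [x] itself, whose entries are cardinalities. *)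
  move=> i; rewrite -mulmxA DzE mulKmx ?unitmx_tr ?Etransform_unit //.
  by rewrite mxE ler0n.
move=> i j ijr; rewrite !hz (mul_subgraph_count hg) //.
by under [X in _ - X]eq_bigr do rewrite hz; rewrite subrr.
Qed.
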